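(* Let $n\geq 3$ and let $G$ be an $(n-1)$-regular bipartite graph whose vertex set is partitioned into two independent sets $V_1$ and $V_2$ with $|V_1|=|V_2|=n$. Then $\beta(G)=n-1$.
   Context: All graphs are finite, simple and connected. $d(u,v)$ denotes the length of a shortest $u$–$v$ path in $G$. For an ordered set $W=\{w_1,\dots,w_k\}\subseteq V(G)$ and $v\in V(G)$, put $r(v\mid W)=(d(v,w_1),\dots,d(v,w_k))$. $W$ is a resolving set of $G$ if $r(x\mid W)\neq r(y\mid W)$ for every two distinct vertices $x,y\in V(G)$. The metric dimension $\beta(G)$ is the minimum cardinality of a resolving set of $G$. A graph is $k$-regular if every vertex is adjacent to exactly $k$ other vertices. *)

(* Defs.v *)
From mathcomp Require Import all_boot.

Set Implicit Arguments.
Unset Strict Implicit.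
Unset Printing Implicit Defensive.

(* A graph on the finite vertex type T is given by its adjacency relation. *)
Definition simple_graph (T : finType) (e : rel T) : Prop :=
  symmetric e /\ irreflexive e.

Definition connected_graph (T : finType) (e : rel T) : Prop :=
  forall u v : T, connect e u v.

Definition regular_graph (T : finType) (e : rel T) (k : nat) : Prop :=
  forall v : T, #|[set w | e v w]| = k.

Definition independent_set (T : finType) (e : rel T) (A : {set T}) : Prop :=
  {in A &, forall x y, ~~ e x y}.

Definition bipartition (T : finType) (e : rel T) (A B : {set T}) : Prop :=
  [/\ A :|: B = [set: T], [disjoint A & B],
      independent_set e A & independent_set e B].

(* The sequence p omits the starting vertex u, so k is the number of edges. *)
Definition has_path_of_length (T : finType) (e : rel T) (u v : T) : pred nat :=
  fun k => [exists p : k.-tuple T,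
    [&& path e u p, last u p == v & uniq (u :: p)]].

(* A path visits each vertex at most once, so its length is below #|T|; the
   value is #|T| when no path from u to v exists. *)
Definition dist (T : finType) (e : rel T) (u v : T) : nat :=
  find (has_path_of_length e u v) (iota 0 #|T|).

Definition metric_repr (T : finType) (e : rel T) (W : seq T) (v : T) : seq nat :=
  [seq dist e v w | w <- W].

(* Ordered sets of vertices are duplicate-free sequences. *)
Definition resolving_set (T : finType) (e : rel T) (W : seq T) : bool :=
  uniq W &&
  [forall x, forall y, (x != y) ==> (metric_repr e W x != metric_repr e W y)].

Definition has_resolving_set_of_size (T : finType) (e : rel T) : pred nat :=
  fun k => [exists W : k.-tuple T, resolving_set e W].

Lemma dist_eq0 (T : finType) (e : rel T) (u v : T) :
  (dist e u v == 0) = (u == v).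
Proof.
rewrite /dist; have /prednK <- : 0 < #|T| by apply/card_gt0P; exists u.
rewrite /=; have -> : has_path_of_length e u v 0 = (u == v).
  apply/existsP/idP => [[p]|uv]; first by rewrite (tuple0 p) /= andbT.
  by exists [tuple]; rewrite /= uv.
by case: (u == v).
Qed.

Lemma has_resolving_set (T : finType) (e : rel T) :
  exists k, has_resolving_set_of_size e k.
Proof.
exists #|T|; apply/existsP; exists (enum_tuple T).
rewrite /resolving_set enum_uniq /=.
apply/forallP => x; apply/forallP => y; apply/implyP; apply: contraNneq.
move=> /eq_in_map/(_ x); rewrite mem_enum => /(_ isT) xy.
by rewrite eq_sym -(dist_eq0 e) -xy dist_eq0.
Qed.

Definition metric_dimension (T : finType) (e : rel T) : nat :=
  ex_minn (has_resolving_set e).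

(* Main.v *)
(* G is K_{n,n} minus a perfect matching: every vertex has exactly one
   non-neighbour ("mate") on the other side, and two distinct vertices on the
   same side are at distance 2.  A set of vertices that avoids two matching
   pairs does not separate the two V1-ends of these pairs, so at least n - 1
   vertices are needed.  Conversely V1 minus a point resolves G: distances to a
   vertex of V1 tell V1 from V2, vertices of V1 are separated by distance 0,
   and vertices of V2 by the distance to their mates. *)

Require Import Defs.
From mathcomp Require Import all_boot.
From mathcomp Require Import zify.

Set Implicit Arguments.
Unset Strict Implicit.
Unset Printing Implicit Defensive.

Lemma has_path_of_length0 (T : finType) (e : rel T) (u v : T) :
  has_path_of_length e u v 0 = (u == v).
Proof.
apply/existsP/idP => [[p]|uv]; first by rewrite (tuple0 p) /= andbT.
by exists [tuple]; rewrite /= uv.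
Qed.

Lemma has_path_of_length1 (T : finType) (e : rel T) (u v : T) :
  irreflexive e -> has_path_of_length e u v 1 = e u v.
Proof.
move=> irr; apply/existsP/idP => [[p]|uv].
  by case/tupleP: p => w p; rewrite (tuple0 p) /= andbT => /and3P[uw /eqP<- _].
exists [tuple v]; rewrite /= uv eqxx inE !andbT /=.
by apply: contraTneq uv => ->; rewrite irr.
Qed.

(** Paths repeat no vertex, so a closed walk through a neighbour of [u] does not count; hence the
    conjunct [u != v]. *)
Lemma has_path_of_length2 (T : finType) (e : rel T) (u v : T) :
  irreflexive e ->
  has_path_of_length e u v 2 = (u != v) && [exists w, e u w && e w v].
Proof.
move=> irr; apply/existsP/andP => [[p]|[uv /existsP[w /andP[uw wv]]]].
  case/tupleP: p => w p; case/tupleP: p => z p; rewrite (tuple0 p) /= !inE.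
  rewrite !andbT => /and3P[/andP[uw wz] /eqP <-].
  rewrite negb_or => /andP[/andP[_ ->] _]; split=> //.
  by apply/existsP; exists w; rewrite uw.
exists [tuple w; v]; rewrite /= uw wv eqxx !inE negb_or uv !andbT /=.
by apply/andP; split; [apply: contraTneq uw | apply: contraTneq wv] => ->;
  rewrite irr.
Qed.

Lemma dist_eq1 (T : finType) (e : rel T) (u v : T) :
  irreflexive e -> (dist e u v == 1) = e u v.
Proof.
move=> irr; have [->|uv] := eqVneq u v.
  by rewrite irr; apply: contra_eqF (dist_eq0 e v v) => /eqP->; rewrite eqxx.
(* With two vertices the search range [iota 0 #|T|] contains 1, so a failed search cannot return 1
   by default. *)
have : 1 < #|T| by apply/card_gt1P; exists u, v.
rewrite /dist; case: #|T| => [|[|k]] //= _.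
rewrite has_path_of_length0 has_path_of_length1 // (negPf uv).
by case: (e u v).
Qed.

(* When [#|T| = 2], [dist e u v = 2] is the value for unreachable vertices. *)
Lemma dist_eq2 (T : finType) (e : rel T) (u v : T) :
  irreflexive e -> 2 < #|T| ->
  (dist e u v == 2) = [&& u != v, ~~ e u v & [exists w, e u w && e w v]].
Proof.
move=> irr; have [->|uv] /= := eqVneq u v.
  by move=> _; apply: contra_eqF (dist_eq0 e v v) => /eqP->; rewrite eqxx.
rewrite /dist; case: #|T| => [|[|[|k]]] //= _.
rewrite has_path_of_length0 has_path_of_length1 // has_path_of_length2 //.
by rewrite uv (negPf uv); case: (e u v) => //; case: existsP.
Qed.

Lemma bipartition_sym (T : finType) (e : rel T) (A B : {set T}) :
  bipartition e A B -> bipartition e B A.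
Proof. by case=> AB dAB iA iB; split; rewrite // 1?setUC // disjoint_sym. Qed.

Lemma bipartition_notin (T : finType) (e : rel T) (A B : {set T}) (x : T) :
  bipartition e A B -> (x \notin A) = (x \in B).
Proof.
case=> AB dAB _ _; have := in_setT x; rewrite -AB inE.
have [xA _|//] := boolP (x \in A).
by rewrite (disjointFr dAB xA).
Qed.

Lemma bipartition_edge (T : finType) (e : rel T) (A B : {set T}) (x y : T) :
  bipartition e A B -> x \in A -> e x y -> y \in B.
Proof.
move=> bip xA; rewrite -(bipartition_notin y bip); case: bip => _ _ iA _.
by apply: contraTN => yA; apply: iA.
Qed.

(** All neighbours of [x] lie in [B], so exactly one element of [B] is missed; [0 < #|B|] keeps the
    subtraction from truncating. *)
Lemma mate_exists (T : finType) (e : rel T) (A B : {set T}) (x : T) :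
  bipartition e A B -> #|[set y | e x y]| = #|B| - 1 -> 0 < #|B| -> x \in A ->
  exists2 a, a \in B & {in B, forall y, e x y = (y != a)}.
Proof.
move=> bip degx B0 xA.
have sNB : [set y | e x y] \subset B.
  by apply/subsetP => y; rewrite inE; apply: bipartition_edge xA.
have /cards1P[a Ba] : #|B :\: [set y | e x y]| == 1.
  by rewrite cardsD (setIidPr sNB) degx subKn.
exists a; first by have := set11 a; rewrite -Ba inE => /andP[].
move=> y yB; have : (y \in B :\: [set y | e x y]) = (y == a) by rewrite Ba inE.
by rewrite !inE yB andbT => <-; rewrite negbK.
Qed.

(** Since [B] has at least three vertices, one of them is the mate of neither [x] nor [y], hence a
    common neighbour. *)
Lemma dist_same_side (T : finType) (e : rel T) (A B : {set T}) (x y : T) :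
  simple_graph e -> bipartition e A B -> regular_graph e (#|B| - 1) ->
  2 < #|B| -> x \in A -> y \in A -> x != y -> dist e x y = 2.
Proof.
move=> [sym irr] bip reg B3 xA yA xy; apply/eqP; rewrite dist_eq2 ?xy //=; last first.
  exact: leq_trans B3 (max_card _).
have B0 : 0 < #|B| by lia.
have [a aB xa] := mate_exists bip (reg x) B0 xA.
have [b bB yb] := mate_exists bip (reg y) B0 yA.
have [_ _ iA _] := bip; rewrite iA //=.
have /card_gt0P[w] : 0 < #|B :\: [set a; b]|.
  rewrite cardsD; have := subset_leq_card (subsetIr B [set a; b]).
  by rewrite cards2; lia.
rewrite !inE negb_or => /andP[/andP[wa wb] wB].
by apply/existsP; exists w; rewrite xa // wa sym yb.
Qed.

(** A parity argument: [dist e x w] is 0 or 2, whereas [y] and [w], on opposite sides, are distinct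
    and have no common neighbour. *)
Lemma dist_sides_neq (T : finType) (e : rel T) (A B : {set T}) (x y w : T) :
  simple_graph e -> bipartition e A B -> regular_graph e (#|B| - 1) ->
  2 < #|B| -> x \in A -> y \in B -> w \in A -> dist e x w != dist e y w.
Proof.
move=> sg bip reg B3 xA yB wA; have [sym irr] := sg.
have bip' := bipartition_sym bip.
have yw : y != w.
  by apply: contraTneq yB => ->; rewrite -(bipartition_notin w bip) wA.
have [->|xw] := eqVneq x w.
  by have /eqP-> : dist e w w == 0; rewrite ?dist_eq0 // eq_sym dist_eq0.
rewrite (dist_same_side sg bip) // eq_sym dist_eq2 ?yw //=; last first.
  exact: leq_trans B3 (max_card _).
apply/negP => /andP[_ /existsP[z /andP[yz zw]]].
have zA := bipartition_edge bip' yB yz.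
by have := bipartition_edge bip zA zw; rewrite -(bipartition_notin w bip) wA.
Qed.

Lemma resolving_setD1 (T : finType) (e : rel T) (A B : {set T}) (a : T) :
  simple_graph e -> bipartition e A B -> regular_graph e (#|B| - 1) ->
  #|A| = #|B| -> 2 < #|B| -> resolving_set e (enum (A :\ a)).
Proof.
move=> sg bip reg cAB B3; have [sym irr] := sg.
have bip' := bipartition_sym bip.
rewrite /resolving_set enum_uniq; apply/forallP => x; apply/forallP => y.
apply/implyP; apply: contraNN => /eqP/eq_in_map Exy.
have {}Exy w : w \in A -> w != a -> dist e x w = dist e y w.
  by move=> wA wa; apply: Exy; rewrite mem_enum !inE wa.
have [xA|] := boolP (x \in A); have [yA|] := boolP (y \in A).
(* A vertex of [A] other than [a] is a landmark, at distance 0 from itself only. *)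
- have [xa|xa] := eqVneq x a; last first.
    by rewrite eq_sym -(dist_eq0 e) -Exy // dist_eq0.
  have [ya|ya] := eqVneq y a; first by rewrite xa ya.
  by rewrite -(dist_eq0 e) Exy // dist_eq0.
- rewrite (bipartition_notin y bip) => yB.
  have /card_gt0P[w] : 0 < #|A :\ a| by have := cardsD1 a A; lia.
  rewrite !inE => /andP[wa wA].
  by have := dist_sides_neq sg bip reg B3 xA yB wA; rewrite Exy // eqxx.
- rewrite (bipartition_notin x bip) => xB.
  have /card_gt0P[w] : 0 < #|A :\ a| by have := cardsD1 a A; lia.
  rewrite !inE => /andP[wa wA].
  by have := dist_sides_neq sg bip reg B3 yA xB wA; rewrite Exy // eqxx.
rewrite !(bipartition_notin _ bip) => yB xB.
have {}Exy w : w \in A -> w != a -> e x w = e y w.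
  by move=> wA wa; rewrite -!dist_eq1 // Exy.
have degA z : #|[set t | e z t]| = #|A| - 1 by rewrite cAB.
have A0 : 0 < #|A| by lia.
have B0 : 0 < #|B| by lia.
have [b bA xb] := mate_exists bip' (degA x) A0 xB.
have [c cA yc] := mate_exists bip' (degA y) A0 yB.
(* If [b] or [c] differs from [a], it is a landmark, and the equal adjacencies of [x] and [y] to it
   force [b = c]; otherwise both are [a]. *)
have bc : b = c.
  have [ba|ba] := eqVneq b a; last first.
    by have := Exy b bA ba; rewrite xb // yc // eqxx => /esym/negbFE/eqP.
  have [ca|ca] := eqVneq c a; first by rewrite ba ca.
  by have := Exy c cA ca; rewrite xb // yc // eqxx => /negbFE/eqP.
(* Being mates is symmetric: [x] and [y] both miss [b], so both equal its unique non-neighbour [z]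
   in [B]. *)
have [z zB bz] := mate_exists bip (reg b) B0 bA.
have /eqP-> : x == z by rewrite -[_ == _]negbK -bz // sym xb // eqxx.
by rewrite eq_sym -[_ == _]negbK -bz // sym yc // bc eqxx.
Qed.

Lemma leq_resolving_set (T : finType) (e : rel T) (A B : {set T}) (W : seq T) :
  simple_graph e -> bipartition e A B -> regular_graph e (#|B| - 1) ->
  #|A| = #|B| -> 2 < #|B| -> resolving_set e W -> #|A| - 1 <= size W.
Proof.
move=> sg bip reg cAB B3 /andP[_ /forallP resW]; have [sym irr] := sg.
have bip' := bipartition_sym bip.
rewrite leqNgt; apply/negP => ltW.
(* [h] sends a vertex to the [A]-end of its matching pair. *)
pose h w := if w \in A then w else odflt w [pick a in A | ~~ e w a].
(* Fewer than [#|A| - 1] landmarks meet at most [#|A| - 2] matching pairs, so two pairs are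
   avoided. *)
have : 1 < #|A :\: [set h w | w in W]|.
  have leW : #|[set h w | w in W]| <= size W.
    exact: leq_trans (leq_imset_card _ _) (card_size _).
  rewrite cardsD.
  have := subset_leq_card (subsetIr A [set h w | w in W]); lia.
case/card_gt1P => x [y []]; rewrite !inE => /andP[xh xA] /andP[yh yA] xy.
(* For such a [z], no landmark is [z] or its mate, so the distance depends only on the side of the
   landmark. *)
have distE z : z \in A -> z \notin [set h w | w in W] ->
    {in W, forall w, dist e z w = if w \in A then 2 else 1}.
  move=> zA zh w wW.
  have {zh} zh : z != h w by apply: contraNneq zh => ->; apply: imset_f.
  case: ifPn => wA.
    by apply: (dist_same_side sg bip) => //; move: zh; rewrite /h wA.
  have wB : w \in B by rewrite -(bipartition_notin w bip).
  have degw : #|[set t | e w t]| = #|A| - 1 by rewrite cAB.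
  have A0 : 0 < #|A| by lia.
  have [b bA wb] := mate_exists bip' degw A0 wB.
  apply/eqP; rewrite dist_eq1 // sym wb //; move: zh; rewrite /h (negPf wA).
  (* The mate [b] makes the search succeed, so the default of [odflt] never occurs, and the vertex
     found must be [b]. *)
  case: pickP => [c /andP[cA]|/(_ b)] /=; last by rewrite bA wb // eqxx.
  by rewrite wb // negbK => /eqP->.
have /forallP/(_ y)/implyP/(_ xy)/eqP[] := resW x.
by apply/eq_in_map => w wW; rewrite !distE.
Qed.

Theorem theorem1 (n : nat) (T : finType) (e : rel T) (V1 V2 : {set T})
  (hn : 3 <= n)
  (hsimple : simple_graph e)
  (hconn : connected_graph e)
  (hreg : regular_graph e (n - 1))
  (hbip : bipartition e V1 V2)
  (hV1 : #|V1| = n)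
  (hV2 : #|V2| = n) :
  metric_dimension e = n - 1.
Proof.
have cV : #|V1| = #|V2| by rewrite hV1.
rewrite -hV2 in hn hreg.
rewrite /metric_dimension; case: ex_minnP => k /existsP[W resW] mink.
apply/eqP; rewrite eqn_leq; apply/andP; split; last first.
  rewrite -(size_tuple W) -hV1.
  exact: (leq_resolving_set hsimple hbip hreg cV hn resW).
have /card_gt0P[a aV1] : 0 < #|V1| by lia.
have sizeV : size (enum (V1 :\ a)) == n - 1.
  by rewrite -cardE; have := cardsD1 a V1; rewrite aV1; lia.
apply: mink; apply/existsP; exists (Tuple sizeV).
exact: (resolving_setD1 a hsimple hbip hreg).
Qed.
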